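(* Consider the plant-sensor-channel-controller model described in the context, with plant dynamics $\dot x=Ax+Bu+w$, estimator dynamics $\dot{\hat x}=A\hat x+Bu$ between receptions, triggering strategy $|z(t)|=J$, and jump strategy $\hat x(t_c^+)=\bar z(t_c)+\hat x(t_c)$. If the controller has enough information about $x(0)$ such that the state estimation error satisfies $|z(0)|<J$, then there exists a quantization policy that achieves, for all $k\in\mathbb{N}$, $$|z(t_c^{k+})|=|z(t_c^k)-\bar z(t_c^k)|\le\rho_0J\quad\text{for all possible }t_c^k\in[t_s^k,t_s^k+\gamma],$$ with a packet size $$g(t_s^k)\ \ge\ \max\left\{0,\ 1+\log_2\frac{Ab\gamma}{\ln\left(1+\frac{\rho_0-\frac{M}{JA}(e^{A\gamma}-1)}{e^{A\gamma}}\right)}\right\},$$ where $b>1$ and $J>\frac{M}{A\rho_0}(e^{A\gamma}-1)$.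
   Context: Model. The plant is the scalar system $\dot x(t)=Ax(t)+Bu(t)+w(t)$, $t\ge0$, with $A>0$, $B\in\mathbb{R}$, state $x(t)\in\mathbb{R}$, control input $u(t)\in\mathbb{R}$ and disturbance $w(t)\in\mathbb{R}$ with $|w(t)|\le M$, $M>0$; the initial condition satisfies $|x(0)|\le L$ for some $L>0$. The sensor measures the state exactly, and the controller acts with infinite precision and without delay. At triggering times $t_s^k$ ($k\in\mathbb{N}$) the sensor sends a packet of $g(t_s^k)$ bits, which the controller receives entirely and without error, and decodes, at the reception time $t_c^k$; the delay $t_c^k-t_s^k$ is unknown and lies in $[0,\gamma]$, where $\gamma\ge0$ is finite. The superscript $k$ is dropped for a generic triggering time $t_s$ and its reception time $t_c$. The sensor is assumed to know the times at which the actuator performs the control action, so that it can also compute $\hat x(t)$ for all $t$. Estimator and jump. The controller's estimate $\hat x$ starts at $\hat x(0)=\hat x_0$ and satisfies $\dot{\hat x}=A\hat x+Bu$ between consecutive reception times; at each reception time it is updated by $\hat x(t_c^+)=\bar z(t_c)+\hat x(t_c)$, where $f(t^+)$ denotes the right-hand limit. The state estimation error is $z(t)=x(t)-\hat x(t)$, so $z(0)=x(0)-\hat x_0$ and $z(t_c^+)=z(t_c)-\bar z(t_c)$. Triggering. A triggering event occurs when $|z(t)|=J$, where $J>0$. Packets and quantization. At a triggering time $t_s$ the sensor sends a packet of $g(t_s)$ bits consisting of the sign of $z(t_s)$ and a quantized version $q(t_s)$ of $t_s$. Using the bound $\gamma$ on the delay and the decoded packet, the controller reconstructs $q(t_s)$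 and sets $\bar z(t_c)=\mathrm{sign}(z(t_s))\,J\,e^{A(t_c-q(t_s))}$. A quantization policy is a rule for this encoding and decoding. The constant $0<\rho_0<1$ is a design parameter. For $\gamma=0$ the logarithm is read as $-\infty$, so that the lower bound is $0$.
   Formalization: Triggering is suspended while a packet is in flight (if z re-hit J before reception and triggered again, the bound can fail); a packet has at least one bit, for the sign; q(t_s) is the controller's reconstruction, which may use t_c. *)

(* Defs.v *)
(* Uses MathComp / MathComp-Analysis. *)
From HB Require Import structures.
From mathcomp Require Import all_boot all_order all_algebra.
From mathcomp Require Import all_classical all_reals all_analysis.
Set Implicit Arguments.
Unset Strict Implicit.
Unset Printing Implicit Defensive.
Import Order.TTheory GRing.Theory Num.Theory numFieldNormedType.Exports.
Local Open Scope classical_set_scope.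
Local Open Scope ring_scope.

(* [y' = A y + v] on [s, t] in the sense of Caratheodory, so that inputs and
   disturbances need not be continuous. *)
Definition linear_flow (R : realType) (A : R) (v y : R -> R) (s t : R) : Prop :=
  (@lebesgue_measure R).-integrable `[s, t]
    (EFin \o (fun r => A * y r + v r)) /\
  y t = y s + \int[@lebesgue_measure R]_(r in `[s, t]) (A * y r + v r).

(* The packet is the sign bit of z(t_s) followed by [time_code t_s].  Besides
   the time code, the controller only has the reception time t_c from which to
   reconstruct q(t_s) (the constants of the model, among them the bound on the
   delay, are fixed before the policy is chosen). *)
Record quantization_policy (R : realType) := QuantizationPolicy {
  time_code : R -> seq bool;
  decode_time : seq bool -> R -> R
}.

Definition packet (R : realType) (P : quantization_policy R) (zs ts : R)
    : seq bool :=
  (0 < zs) :: time_code P ts.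

Definition decode_sign (R : realType) (p : seq bool) : R :=
  if head false p then 1 else -1.

(* [\bar z (t_c)], a function of the received packet and of t_c only. *)
Definition zbar (R : realType) (A J : R) (P : quantization_policy R)
    (p : seq bool) (tc : R) : R :=
  decode_sign R p * J * expR (A * (tc - decode_time P (behead p) tc)).

(* The reception preceding the k-th triggering; time 0 if there is none. *)
Definition last_reception (R : realType) (tc : nat -> \bar R) (k : nat)
    : \bar R :=
  if k is j.+1 then tc j else 0%E.

(* Executions of the closed loop on [0, +oo[.  The k-th triggering and
   reception times (k = 0, 1, ...) are [ts k] and [tc k], equal to +oo when
   fewer than k + 1 events occur.  The estimate is left-continuous at reception
   times: [xh c] is its value before the jump. *)
Record execution (R : realType) (A B M L J gamma xh0 : R)
    (P : quantization_policy R) (x xh u w : R -> R) (ts tc : nat -> \bar R)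
    : Prop := Execution {
  ex_disturbance : forall t, 0 <= t -> `|w t| <= M;
  ex_init : `|x 0| <= L;
  ex_plant : forall s t, 0 <= s -> s <= t ->
    linear_flow A (fun r => B * u r + w r) x s t;
  ex_est_init : xh 0 = xh0;
  ex_est_flow : forall s t, 0 <= s -> s <= t ->
    (forall k, ~ (s%:E <= tc k < t%:E)%E) ->
    linear_flow A (fun r => B * u r) xh s t;
  ex_jump : forall k s c, ts k = s%:E -> tc k = c%:E ->
    xh t @[t --> c^'+] --> zbar A J P (packet P (x s - xh s) s) c + xh c;
  ex_delay : forall k, (ts k <= tc k <= ts k + gamma%:E)%E;
  (* [ts k] is the first time after the previous reception at which
     |x - xh| = J. *)
  ex_order : forall k,
    (last_reception tc k < ts k)%E \/ ts k = +oo%E;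
  ex_trigger : forall k s, ts k = s%:E -> `|x s - xh s| = J;
  ex_no_trigger : forall k t, (last_reception tc k < t%:E < ts k)%E ->
    `|x t - xh t| <> J
}.

Definition log2 (R : realType) (y : R) : R := ln y / ln 2.

(* The library's [ln] is 0 at 0, hence the separate case [gamma = 0], where the
   logarithm below stands for -oo. *)
Definition packet_size_bound (R : realType) (A M J gamma rho0 b : R) : R :=
  if gamma == 0 then 0 else
  Num.max 0
    (1 + log2 (A * b * gamma /
               ln (1 + (rho0 - M / (J * A) * (expR (A * gamma) - 1))
                       / expR (A * gamma)))).

(* Main.v *)
(* Let [beta] be the quotient added to 1 inside the logarithm of the bound, and
   [eps = ln (1 + beta) / A].  The error obeys [z' = A z + w] between t_s and
   t_c, so a Gronwall estimate leaves z(t_c) within [M / A (e^(A gamma) - 1)] of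
   [e^(A (t_c - t_s)) z(t_s)]; if moreover [|t_s - q(t_s)| <= eps], the jump is
   within [J e^(A gamma) beta] of the latter, and the two errors add up to
   [rho0 J].

   To reach the precision [eps], cut the time axis into cells of width [2 eps]
   and send the index of the cell of t_s modulo [2 ^ n], where [n = g(t_s) - 1].
   The size bound says [2 ^ n eps >= b gamma], so only one cell with the
   received code can meet [t_c - gamma, t_c] when [n >= 1], and q is its
   midpoint; when [n = 0], [gamma <= eps] and [q = t_c] is good enough. *)
Require Import Defs.
From HB Require Import structures.
From mathcomp Require Import all_boot all_order all_algebra.
From mathcomp Require Import all_classical all_reals all_analysis.
From mathcomp Require Import ring lra.
Import Order.TTheory GRing.Theory Num.Theory numFieldNormedType.Exports.
Local Open Scope classical_set_scope.
Local Open Scope ring_scope.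

Set Implicit Arguments.
Unset Strict Implicit.

(** * Gronwall estimate for flows in the sense of Caratheodory *)

(** The majorant [c + U t] obeys [U' = A phi + m <= A (c + U) + m], so [c + U + m / A] times the
    integrating factor [E] is nonincreasing. The integral form suits a [z] that need not be
    differentiable. *)
Lemma gronwall (R : realType) (A m c a b : R) (phi : R -> R) :
  0 < A -> a <= b -> {within `[a, b], continuous phi} ->
  (forall t, a <= t <= b -> phi t <=
     c + \int[@lebesgue_measure R]_(r in `[a, t]) (A * phi r + m)) ->
  phi b <= expR (A * (b - a)) * (c + m / A) - m / A.
Proof.
move=> A0 ab cphi phi_le; set mu := @lebesgue_measure R.
have chi : {within `[a, b], continuous (fun r => A * phi r + m)}.
  move=> r; apply: cvgD; last exact: cvg_cst.
  by apply: cvgM; [exact: cvg_cst|exact: cphi].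
have ihi : mu.-integrable `[a, b] (EFin \o (fun r => A * phi r + m)).
  by apply: continuous_compact_integrable => //; exact: segment_compact.
pose U t := \int[mu]_(r in `[a, t]) (A * phi r + m).
pose E t : R := expR (- (A * (t - a))).
pose V t := E t * (c + U t + m / A).
have dE (t : R) : is_derive t 1 E (- (A * E t)).
  rewrite /E; apply: is_derive_eq.
  by rewrite /GRing.scale/=; ring.
have cU : {within `[a, b], continuous U}.
  exact: parameterized_integral_continuous.
have cV : {within `[a, b], continuous V}.
  move=> t; apply: cvgM.
    apply: continuous_subspaceT => {}t.
    apply/differentiable_continuous/derivable1_diffP.
    by have [] := dE t.
  apply: cvgD; last exact: cvg_cst.
  by apply: cvgD; [exact: cvg_cst|exact: cU].
have dV (t : R) : t \in `]a, b[ ->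
    is_derive t 1 V (E t * (A * phi t + m) - A * E t * (c + U t + m / A)).
  move=> tab.
  have [at_ tb] : a < t /\ t < b by move: tab; rewrite in_itv/= => /andP[].
  have chit : {for t, continuous (fun r => A * phi r + m)}.
    by move/(continuous_within_itvP _ (lt_trans at_ tb)) : chi => -[/(_ t tab)].
  have [dU U'] := continuous_FTC1_closed tb ihi at_ chit.
  rewrite -/U in dU U'.
  have dU' : is_derive t 1 U (A * phi t + m).
    by apply: DeriveDef; [exact: dU|rewrite -derive1E; exact: U'].
  rewrite /V; apply: is_derive_eq.
  by rewrite /GRing.scale/=; ring.
have : V b <= V a.
  apply: (ler0_derive1_nincr _ _ cV (lexx a) ab (lexx b)) => t tab.
    by have [] := dV t tab.
  have [_] := dV t tab; rewrite derive1E => ->.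
  have phit : phi t <= c + U t.
    by apply: phi_le; move: tab; rewrite in_itv/= => /andP[/ltW-> /ltW->].
  have -> : E t * (A * phi t + m) - A * E t * (c + U t + m / A) =
      A * E t * (phi t - (c + U t)).
    by field; rewrite gt_eqF.
  rewrite mulr_ge0_le0 ?subr_le0// mulr_ge0 ?expR_ge0// ltW//.
(* [U a] is an integral over a single point, so [V a = c + m / A]. *)
rewrite /V {2}/E subrr mulr0 oppr0 expR0 mul1r {2}/U set_itv1 Rintegral_set1.
rewrite addr0 /E expRN mulrC ler_pdivrMr ?expR_gt0// [X in _ <= X]mulrC => Vb.
rewrite lerBrDr (le_trans _ Vb)// lerD2r.
by apply: phi_le; rewrite ab lexx.
Qed.

Lemma linear_flow_continuous (R : realType) (A a b : R) (v y : R -> R) :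
  a <= b -> (forall t, a <= t <= b -> linear_flow A v y a t) ->
  {within `[a, b], continuous y}.
Proof.
move=> ab yP; pose f r := A * y r + v r.
have [fi _] : linear_flow A v y a b by apply: yP; rewrite ab lexx.
apply: (@subspace_eq_continuous _ _ _
  (fun t => y a + \int[@lebesgue_measure R]_(r in `[a, t]) f r)).
  move=> t; rewrite inE/= in_itv/= => tab.
  by have [_ <-] := yP t tab.
move=> t; apply: cvgD; first exact: cvg_cst.
exact: parameterized_integral_continuous.
Qed.

Lemma linear_flowB (R : realType) (A s t : R) (v1 v2 y1 y2 : R -> R) :
  linear_flow A v1 y1 s t -> linear_flow A v2 y2 s t ->
  linear_flow A (fun r => v1 r - v2 r) (fun r => y1 r - y2 r) s t.
Proof.
move=> [i1 e1] [i2 e2].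
rewrite /linear_flow (_ : (fun r => A * (y1 r - y2 r) + _) =
    (fun r => (A * y1 r + v1 r) - (A * y2 r + v2 r))); last first.
  by apply/funext => r; ring.
split; first exact: (integrableB _ i1 i2).
by rewrite e1 e2 RintegralB//; ring.
Qed.

(** Gronwall is applied to [z] and to [- z] with [m = M]; applied to [|z|] it would lose the
    comparison with the free solution [expR (A * (t - s)) * z s]. *)
Lemma linear_flow_dist (R : realType) (A M s t : R) (v z : R -> R) :
  0 < A -> s <= t -> (forall r, s <= r <= t -> `|v r| <= M) ->
  (forall r, s <= r <= t -> linear_flow A v z s r) ->
  `|z t - expR (A * (t - s)) * z s| <= M / A * (expR (A * (t - s)) - 1).
Proof.
move=> A0 st vM zP.
have cz := linear_flow_continuous st zP.
have sub r : r <= t -> `[s, r] `<=` `[s, t].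
  by move=> rt; apply: subset_itvl; rewrite bnd_simp.
have i_aff (y : R -> R) r : {within `[s, t], continuous y} -> s <= r <= t ->
    (@lebesgue_measure R).-integrable `[s, r] (EFin \o (fun q => A * y q + M)).
  move=> cy /andP[sr rt]; apply: continuous_compact_integrable.
    exact: segment_compact.
  apply: (continuous_subspaceW (sub _ rt)) => q.
  apply: cvgD; last exact: cvg_cst.
  by apply: cvgM; [exact: cvg_cst|exact: cy].
have cNz : {within `[s, t], continuous (fun r => - z r)}.
  by move=> r; apply: cvgN; exact: cz.
have up : z t <= expR (A * (t - s)) * (z s + M / A) - M / A.
  apply: gronwall => // r srt; have [fi {1}->] := zP r srt.
  rewrite lerD2l; apply: le_Rintegral => //.
    exact: i_aff.
  move=> q /=; rewrite in_itv/= => /andP[sq qr]; rewrite lerD2l.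
  rewrite (le_trans (ler_norm _))// vM// sq (le_trans qr)//.
  by case/andP: srt.
have lo : - z t <= expR (A * (t - s)) * (- z s + M / A) - M / A.
  apply: (@gronwall _ _ _ _ _ _ (fun r => - z r)) => //.
  move=> r srt; have [fi {1}->] := zP r srt.
  rewrite opprD lerD2l -mulN1r -RintegralZl//.
  apply: le_Rintegral => //.
  - apply: eq_integrable (integrableZl _ (-1) fi) => //.
  - exact: i_aff.
  move=> q /=; rewrite in_itv/= => /andP[sq qr].
  rewrite mulN1r opprD mulrN lerD2l.
  rewrite (le_trans (ler_norm _))// normrN vM// sq (le_trans qr)//.
  by case/andP: srt.
rewrite ler_norml; apply/andP; split; lra.
Qed.

(** * Quantization of the triggering time *)

(** Any enumeration of the words of length [n] would serve: what matters is the length and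
    injectivity below [2 ^ n]. *)
Definition bits (n m : nat) : seq bool :=
  nth [::] [seq val w | w <- enum {: n.-tuple bool}] m.

Lemma size_bits (n m : nat) : (m < 2 ^ n)%N -> size (bits n m) = n.
Proof.
move=> mn; have mE : (m < size (enum {: n.-tuple bool}))%N.
  by rewrite -cardE card_tuple card_bool.
have w0 : n.-tuple bool by exact: [tuple false | i < n].
by rewrite /bits (nth_map w0)// size_tuple.
Qed.

Lemma bits_inj (n : nat) : {in [pred m | (m < 2 ^ n)%N] &, injective (bits n)}.
Proof.
move=> m1 m2; rewrite !inE => lt1 lt2 /eqP; rewrite nth_uniq; first by move/eqP.
- by rewrite size_map -cardE card_tuple card_bool.
- by rewrite size_map -cardE card_tuple card_bool.
- by rewrite map_inj_uniq ?enum_uniq//; exact: val_inj.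
Qed.

Section quantizer.
Context (R : realType).
Implicit Types (g : R -> nat) (gamma eps s t : R).

Definition cell eps s : nat := Num.truncn (s / (2 * eps)).

(** The sign takes one of the [g s] bits. The modulus varies with [s], but the length of the word
    reveals it. *)
Definition cell_code g eps s : seq bool :=
  bits (g s).-1 (cell eps s %% 2 ^ (g s).-1)%N.

Lemma size_cell_code g eps s : size (cell_code g eps s) = (g s).-1.
Proof. by rewrite size_bits// ltn_mod expn_gt0. Qed.

Lemma cell_itv eps s : 0 < eps -> 0 <= s ->
  (cell eps s)%:R * (2 * eps) <= s < ((cell eps s)%:R + 1) * (2 * eps).
Proof.
move=> e0 s0; have e20 : 0 < 2 * eps by lra.
have := truncn_itv (divr_ge0 s0 (ltW e20)).
by rewrite ler_pdivlMr// ltr_pdivrMr// natr1.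
Qed.

(* Equal codes of at least one bit belong to cells equal modulo [2 ^ n], and
   [(2 ^ n - 1) * (2 * eps) >= 2 ^ n * eps >= gamma]. *)
Lemma eq_cell g gamma eps s t : 0 < eps -> 0 <= s <= t -> t <= s + gamma ->
  (1 < g s)%N -> gamma <= 2 ^+ (g s).-1 * eps ->
  cell_code g eps s = cell_code g eps t -> cell eps s = cell eps t.
Proof.
move=> e0 /andP[s0 st] tsg gs ge eqc.
have gE : (g t).-1 = (g s).-1.
  by rewrite -(size_cell_code g eps t) -eqc size_cell_code.
have le_st : (cell eps s <= cell eps t)%N.
  by apply: le_truncn; rewrite ler_pM2r// invr_gt0; lra.
have eq_mod : cell eps t = cell eps s %[mod 2 ^ (g s).-1].
  move: eqc; rewrite /cell_code gE => /bits_inj ->//;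
    by rewrite inE ltn_mod expn_gt0.
apply/eqP; rewrite eqn_leq le_st leqNgt; apply/negP => lt_st.
have : (2 ^ (g s).-1 %| cell eps t - cell eps s)%N by rewrite -eqn_mod_dvd// eq_mod.
move=> /dvdn_leq; rewrite subn_gt0 => /(_ lt_st).
rewrite leq_subRL// -(ler_nat R) natrD natrX => le_cells.
(* Cells are open on the right, so with [n = (g s).-1] the gap [t - s] strictly exceeds
   [(2 ^ n - 1) * (2 * eps)]; this excludes even [t - s = gamma]. *)
have /andP[_ ub] := cell_itv e0 s0.
have /andP[lb _] := cell_itv e0 (le_trans s0 st).
have pow2 : 2 <= 2 ^+ (g s).-1 :> R.
  by rewrite -[leLHS]expr1 ler_eXn2l ?ltr1n// -ltnS prednK// ltnW.
have : (cell eps s)%:R * (2 * eps) + 2 ^+ (g s).-1 * (2 * eps) <= t.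
  by rewrite (le_trans _ lb)// -mulrDl ler_pM2r//; lra.
have : 2 * eps <= 2 ^+ (g s).-1 * eps by rewrite ler_pM2r.
lra.
Qed.

(** Since [q] is quantified before [s], it depends only on the word and the reception time. Times
    compatible with both lie in [[c - gamma, c]]; for a nonempty word [eq_cell] puts them all in one
    cell, so any one of them determines the midpoint. *)
Lemma cell_code_decodable g gamma eps : 0 < eps ->
  (forall t, 0 <= t -> (0 < g t)%N) ->
  (forall t, 0 <= t -> gamma <= 2 ^+ (g t).-1 * eps) ->
  forall (d : seq bool) (c : R), exists q : R, forall s,
    0 <= s -> s <= c <= s + gamma -> cell_code g eps s = d -> `|s - q| <= eps.
Proof.
move=> e0 g0 gP d c.
have [[s [s0 sc sd]]|no_s] := pselect (exists s : R,
    [/\ 0 <= s, s <= c <= s + gamma & cell_code g eps s = d]); last first.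
  by exists 0 => s s0 sc sd; case: no_s; exists s.
have szd t : 0 <= t -> cell_code g eps t = d -> g t = (size d).+1.
  by move=> t0 <-; rewrite size_cell_code prednK// g0.
have [d0|d0] := posnP (size d).
  exists c => t t0 /andP[tc ct] td.
  have := gP t t0; rewrite (szd t)// d0 expr0 mul1r => ge.
  by rewrite ler_norml; lra.
exists (((cell eps s)%:R + 2^-1) * (2 * eps)) => t t0 tc td.
have -> : cell eps s = cell eps t.
  case/andP: sc => sc cs; case/andP: tc => tc ct.
  (* [eq_cell] takes the earlier time first, hence the two cases. *)
  have [st|/ltW ts] := leP s t.
    apply: (@eq_cell g gamma) => //; rewrite ?s0 ?(szd s)//; last by rewrite td.
      lra.
    by rewrite -(szd s) ?gP.
  apply/esym/(@eq_cell g gamma) => //; rewrite ?t0 ?(szd t)//; last by rewrite sd.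
    lra.
  by rewrite -(szd t) ?gP.
have /andP[] := cell_itv e0 t0.
by rewrite ler_norml; lra.
Qed.

End quantizer.

(** On the lower side [expR y >= 1 / (1 + beta) >= 1 - beta], so [ln (1 + beta)] is a tolerance for
    both signs of [y]. *)
Lemma expR_dist1 (R : realType) (beta y : R) :
  0 <= beta -> `|y| <= ln (1 + beta) -> `|1 - expR y| <= beta.
Proof.
move=> b0; have b1 : 0 < 1 + beta by lra.
rewrite ler_norml => /andP[ly yl].
have up : expR y <= 1 + beta by rewrite -[leRHS]lnK ?posrE// ler_expR.
have lo : expR (- y) <= 1 + beta by rewrite -[leRHS]lnK ?posrE// ler_expR; lra.
have e1 : expR (- y) * expR y = 1 by rewrite -expRD addNr expR0.
have := expR_gt0 y; have := expR_gt0 (- y).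
by rewrite ler_norml; nra.
Qed.

(** * Order of triggering and reception times *)

Section reception_times.
Context (R : realType) (A B M L J gamma xh0 : R) (P : quantization_policy R).
Context (x xh u w : R -> R) (ts tc : nat -> \bar R).
Hypothesis ex : execution A B M L J gamma xh0 P x xh u w ts tc.

Lemma last_reception_le k : (last_reception tc k <= ts k)%E.
Proof. by have [/ltW//|->] := ex_order ex k; rewrite leey. Qed.

Lemma trigger_le k : (ts k <= tc k)%E.
Proof. by have /andP[] := ex_delay ex k. Qed.

Lemma reception_homo : {homo tc : j k / (j <= k)%N >-> (j <= k)%E}.
Proof.
apply: homo_leq => [//|v y z|k]; first exact: le_trans.
apply: le_trans (trigger_le k.+1); exact: last_reception_le k.+1.
Qed.

Lemma trigger_ge0 k : (0 <= ts k)%E.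
Proof.
apply: le_trans (last_reception_le k); case: k => [|k]; first exact: lexx.
apply: le_trans (reception_homo (leq0n k)).
apply: le_trans (trigger_le 0); exact: last_reception_le 0.
Qed.

(** Receptions of index at least [k] do not precede [tc k]; earlier ones occur no later than
    [last_reception tc k], which is strictly before [s]. Hence the estimate flows without jumps from
    [s] to [tc k]. *)
Lemma no_reception k j s : ts k = s%:E -> ~ (s%:E <= tc j < tc k)%E.
Proof.
move=> tsk /andP[sj jk]; have [kj|jk'] := leqP k j.
  by move: jk; rewrite ltNge reception_homo.
have [|] := ex_order ex k; rewrite tsk //.
case: k jk' {jk tsk} => //= k jk; apply/negP; rewrite -leNgt.
apply: le_trans sj _; exact: reception_homo.
Qed.

End reception_times.

(** * From the packet size to the accuracy of the jump *)

(** For [gamma > 0], exponentiating in base 2 gives [b * gamma <= 2 ^+ n.-1 * (ln (1 + beta) / A)],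
    where the [1 +] of the bound pays for the sign bit; then [gamma <= b * gamma]. *)
Lemma packet_size_bound_le (R : realType) (A M J gamma rho0 b : R) (n : nat) :
  let beta := (rho0 - M / (J * A) * (expR (A * gamma) - 1)) / expR (A * gamma) in
  0 < A -> 0 <= gamma -> 1 < b -> 0 < beta -> (0 < n)%N ->
  packet_size_bound A M J gamma rho0 b <= n%:R ->
  gamma <= 2 ^+ n.-1 * (ln (1 + beta) / A).
Proof.
move=> beta A0 gamma0 b1 beta0 n0.
have ln0 : 0 < ln (1 + beta) by rewrite ln_gt0//; lra.
rewrite /packet_size_bound -/beta; case: eqP => [->|/eqP gammaN0].
  by rewrite mulr_ge0// ?exprn_ge0// divr_ge0// ltW.
have {}gamma0 : 0 < gamma by rewrite lt_def gammaN0.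
have X0 : 0 < A * b * gamma / ln (1 + beta).
  by rewrite divr_gt0// !mulr_gt0//; lra.
rewrite ge_max => /andP[_]; rewrite -[in leRHS](prednK n0) -natr1 addrC lerD2r.
rewrite /log2 ler_pdivrMr ?ln_gt0 ?ltr1n// mulr_natl -lnXn//.
rewrite ler_ln ?posrE ?exprn_gt0// ler_pdivrMr// mulrA ler_pdivlMr// => le_pow.
apply: le_trans le_pow; rewrite [leLHS]mulrC -mulrA ler_pM2l//.
by rewrite ler_peMl ?(ltW gamma0)// ltW.
Qed.

Theorem theorem1 (R : realType) (A B M L J gamma rho0 b xh0 : R) (g : R -> nat)
    (hA : 0 < A) (hM : 0 < M) (hL : 0 < L) (hgamma : 0 <= gamma)
    (hrho0 : 0 < rho0 < 1) (hb : 1 < b) (hJ0 : 0 < J)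
    (hJ : M / (A * rho0) * (expR (A * gamma) - 1) < J)
    (hg0 : forall t : R, 0 <= t -> (0 < g t)%N)
    (hg : forall t : R, 0 <= t ->
      packet_size_bound A M J gamma rho0 b <= (g t)%:R) :
  exists P : quantization_policy R,
    (forall zs t : R, 0 <= t -> size (packet P zs t) = g t) /\
    forall (x xh u w : R -> R) (ts tc : nat -> \bar R),
      execution A B M L J gamma xh0 P x xh u w ts tc ->
      `|x 0 - xh 0| < J ->
      forall (k : nat) (s c : R), ts k = s%:E -> tc k = c%:E ->
        let z := fun t => x t - xh t in
        let zb := zbar A J P (packet P (z s) s) c in
        z t @[t --> c^'+] --> z c - zb /\ `|z c - zb| <= rho0 * J.
Proof.
case/andP: hrho0 => rho0_gt0 rho0_lt1.
pose E := expR (A * gamma); have E0 : 0 < E := expR_gt0 _.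
pose beta := (rho0 - M / (J * A) * (E - 1)) / E.
have beta0 : 0 < beta.
  rewrite divr_gt0// subr_gt0.
  (* Multiplied by [rho0 / J], [hJ] becomes the positivity of the numerator of [beta]. *)
  have -> : M / (J * A) * (E - 1) = M / (A * rho0) * (E - 1) * (rho0 / J).
    by field; rewrite !gt_eqF.
  by rewrite mulrA ltr_pdivrMr// mulrC ltr_pM2l.
pose eps := ln (1 + beta) / A.
have eps0 : 0 < eps by rewrite divr_gt0// ln_gt0//; lra.
have gP t : 0 <= t -> gamma <= 2 ^+ (g t).-1 * eps.
  by move=> t0; apply: packet_size_bound_le (hg t t0) => //; exact: hg0.
(* Choice turns decodability at each word and reception time into a decoding function. *)
have dec d c := cid (cell_code_decodable eps0 hg0 gP d c).
exists (QuantizationPolicy (cell_code g eps) (fun d c => sval (dec d c))).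
set P := QuantizationPolicy _ _; split.
  by move=> zs t t0; rewrite /= size_cell_code prednK ?hg0.
move=> x xh u w ts tc ex _ k s c tsk tck z zb.
have s0 : 0 <= s by rewrite -lee_fin -tsk (trigger_ge0 ex).
have [sc cs] : s <= c /\ c <= s + gamma.
  by have := ex_delay ex k; rewrite tsk tck -EFinD !lee_fin => /andP[].
have zbE : zb = decode_sign R (packet P (z s) s) * J *
    expR (A * (c - sval (dec (cell_code g eps s) c))) by [].
set q := sval _ in zbE.
have sq : `|s - q| <= eps.
  by apply: (svalP (dec (cell_code g eps s) c)) => //; rewrite sc cs.
(* Since [|z s| = J] at a triggering, the sign bit gives back [z s] exactly; the time alone is
   quantized. *)
have zsE : decode_sign R (packet P (z s) s) * J = z s.
  rewrite /decode_sign/= -(ex_trigger ex tsk) -/(z s).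
  by case: ltrP => [/gtr0_norm|/ler0_norm] ->; rewrite ?mul1r// mulN1r opprK.
rewrite zsE in zbE; split.
  (* [ex_jump] gives the right limit of [xh]; that of [x] comes from continuity of the plant flow on
     [[c, c + 1]]. *)
  have -> : z c - zb = x c - (zb + xh c) by rewrite /z; ring.
  apply: cvgB; last exact: (ex_jump ex tsk tck).
  have c1 : c < c + 1 by lra.
  have : {within `[c, c + 1], continuous x}.
    apply: (@linear_flow_continuous _ A _ _ (fun r => B * u r + w r)).
      exact: ltW.
    by move=> t /andP[ct _]; apply: (ex_plant ex) => //; lra.
  by move/(continuous_within_itvP _ c1) => -[].
(* The control cancels in [x - xh], leaving a flow driven by [w] alone. *)
have zflow r : s <= r <= c ->
    linear_flow A (fun r => B * u r + w r - B * u r) z s r.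
  move=> /andP[sr rc]; apply: linear_flowB; first exact: (ex_plant ex).
  apply: (ex_est_flow ex) => // j /andP[sj jr].
  apply: (no_reception ex (j := j) tsk); rewrite sj tck/=.
  by rewrite (lt_le_trans jr)// lee_fin.
have dist_free := linear_flow_dist hA sc _ zflow.
have {dist_free} : `|z c - expR (A * (c - s)) * z s| <= M / A * (E - 1).
  apply: le_trans (dist_free M _) _.
    move=> r /andP[sr rc]; rewrite addrAC subrr add0r.
    by apply: (ex_disturbance ex); lra.
  rewrite ler_pM2l ?divr_gt0// lerD2r ler_expR ler_pM2l//; lra.
have : `|expR (A * (c - s)) * z s - zb| <= E * J * beta.
  (* [zb] is the free solution times [expR (A * (s - q))], whose exponent is at most
     [A * eps = ln (1 + beta)] in absolute value. *)
  have -> : expR (A * (c - s)) * z s - zb =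
      expR (A * (c - s)) * z s * (1 - expR (A * (s - q))).
    rewrite zbE [RHS]mulrBr mulr1; congr (_ - _).
    rewrite mulrAC -expRD mulrC; congr (expR _ * _); ring.
  rewrite !normrM (ex_trigger ex tsk) ger0_norm ?expR_ge0//.
  rewrite ler_pM ?mulr_ge0 ?expR_ge0 ?(ltW hJ0)//.
    by rewrite ler_pM2r// ler_expR ler_pM2l//; lra.
  apply: expR_dist1; first exact: ltW.
  by rewrite normrM gtr0_norm// mulrC -ler_pdivlMr.
(* [beta] is the solution of this equation: the quantization error gets what the disturbance leaves
   of [rho0 * J]. *)
have -> : E * J * beta = rho0 * J - M / A * (E - 1).
  by rewrite /beta; field; rewrite !gt_eqF.
move=> d1 d2; rewrite -[z c](subrK (expR (A * (c - s)) * z s)) -addrA.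
apply: le_trans (ler_normD _ _) _; lra.
Qed.
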